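(* Let $G$ be a weakly connected and weight-balanced weighted directed graph on $N$ nodes with Laplacian matrix $L$, and let $\Delta>0$. Consider the hybrid system (H) of consensus with hysteretic quantizers described in the context. For every initial condition $z(0,0)\in X_0$, the set of switching times of the complete solution $z(t,j)$ is locally finite, i.e. every compact subset of $\mathbb{R}_{\ge0}$ contains only finitely many switching times.
   Context: A weighted directed graph $G=(V,E,A)$ has node set $V=\{1,\dots,N\}$, edge set $E\subset V\times V$ without self-loops, and adjacency matrix $A\in\mathbb{R}_{\ge0}^{N\times N}$ with $A_{ij}>0$ if $(j,i)\in E$ and $A_{ij}=0$ otherwise. It is weight-balanced if $\sum_j A_{ij}=\sum_j A_{ji}$ for every $i$; weakly connected if any two nodes are joined by a path of edges, disregarding orientation. $L=\mathrm{diag}(A\mathbf 1)-A$ is the Laplacian, with $\mathbf 1$ the all-ones vector. Hybrid system (H). Let $Q=\Delta\mathbb{Z}\cup(\Delta\mathbb{Z}+\Delta/2)$ and $X=\mathbb{R}^N\times Q^N$, with states $z=(x,q)$. Let $C=\{(x,q)\in X:\ q_i-\frac\Delta2<x_i<q_i+\frac\Delta2\ \forall i\in V\}$ and $D=X\setminus C$, i.e. $D=\{(x,q)\in X:\exists i\in V,\ x_i\le q_i-\frac\Delta2\text{ or }x_i\ge q_i+\frac\Delta2\}$. On $C$ the state flows: $\dot z=f(z)$, i.e. $\dot x=-Lq$, $\dot q=0$. On $D$ the state jumps: $z^+=g(z)$, i.e. $x^+=x$ and, for each $i$, $q_i^+=q_i+\frac\Delta2$ if $x_i\ge q_i+\frac\Delta2$,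 $q_i^+=q_i-\frac\Delta2$ if $x_i\le q_i-\frac\Delta2$, $q_i^+=q_i$ otherwise. Initial conditions belong to $X_0=\{(x,q)\in X:\ q_i-\frac\Delta2\le x_i<q_i+\frac\Delta2\ \forall i\in V\}$. A hybrid time domain is a subset of $\mathbb{R}_{\ge0}\times\mathbb{N}$ that is the union of infinitely many intervals $[t_j,t_{j+1}]\times\{j\}$, $j=0,1,2,\dots$, with $0=t_0\le t_1\le t_2\le\cdots$, or of finitely many such intervals, with the last one possibly of the form $[t_j,t_{j+1}]\times\{j\}$, $[t_j,t_{j+1})\times\{j\}$ or $[t_j,+\infty)\times\{j\}$. A solution is a function $z(t,j)$ defined on a hybrid time domain $\mathrm{dom}\,z$, such that $t\mapsto z(t,j)$ is locally absolutely continuous on $I_j=\{t:(t,j)\in\mathrm{dom}\,z\}$ for each $j$, $z(0,0)\in C\cup D$, and: (a) for each $j$ such that $I_j$ has nonempty interior, $\dot z(t,j)=f(z(t,j))$ for a.e. $t\in I_j$ and $z(t,j)\in C$ for all $t\in[\min I_j,\sup I_j)$; (b) for each $(t,j)\in\mathrm{dom}\,z$ with $(t,j+1)\in\mathrm{dom}\,z$, $z(t,j)\in D$ and $z(t,j+1)=g(z(t,j))$. A solution is complete if $\mathrm{dom}\,z$ is unbounded; for every initial condition in $X_0$ a complete solution exists and is unique. The switching times of $z$ are the times $t$ for which there is $j$ with $(t,j)\in\mathrm{dom}\,z$ and $(t,j+1)\in\mathrm{dom}\,z$. *)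

(* Defs.v *)
From HB Require Import structures.
From mathcomp Require Import all_boot all_order all_algebra.
From mathcomp Require Import all_classical all_reals all_analysis.

Set Implicit Arguments.
Unset Strict Implicit.
Unset Printing Implicit Defensive.

Import Order.TTheory GRing.Theory Num.Theory.
Import numFieldNormedType.Exports.

Local Open Scope classical_set_scope.
Local Open Scope ring_scope.

(* [edge j i] is an edge from j to i; its weight is the entry (i, j) of the
   adjacency matrix, not the entry (j, i). *)
Record wdigraph (R : realType) (N : nat) := WDigraph {
  edge : rel 'I_N;
  adjmx : 'M[R]_N;
  edge_irr : irreflexive edge;
  adjmx_gt0 : forall i j, edge j i -> 0 < adjmx i j;
  adjmx_eq0 : forall i j, ~~ edge j i -> adjmx i j = 0 }.

Definition weight_balanced (R : realType) (N : nat) (G : wdigraph R N) :=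
  forall i, \sum_j adjmx G i j = \sum_j adjmx G j i.

Definition weakly_connected (R : realType) (N : nat) (G : wdigraph R N) :=
  forall i j, connect [rel u v | edge G u v || edge G v u] i j.

Definition laplacian (R : realType) (N : nat) (G : wdigraph R N) : 'M[R]_N :=
  diag_mx (adjmx G *m const_mx 1)^T - adjmx G.

Definition abs_continuous (R : realType) (V : normedModType R) (a b : R)
    (f : R -> V) :=
  forall e : R, 0 < e -> exists2 d : R, 0 < d &
    forall (n : nat) (u v : 'I_n -> R),
      (forall k, a <= u k /\ u k <= v k /\ v k <= b) ->
      trivIset setT (fun k => `]u k, v k[%classic) ->
      \sum_k (v k - u k) < d ->
      \sum_k `|f (v k) - f (u k)| < e.

(* For an interval I; only the values of f on I matter. *)
Definition locally_abs_continuous (R : realType) (V : normedModType R)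
    (I : set R) (f : R -> V) :=
  forall a b : R, a <= b -> `[a, b]%classic `<=` I -> abs_continuous a b f.

Definition hybrid_time_domain (R : realType) (E : set (R * nat)) :=
  exists t : nat -> R, [/\ t 0%N = 0, nondecreasing_seq t &
    E = \bigcup_j (`[t j, t j.+1]%classic `*` [set j]) \/
    exists (J : nat) (I : set R),
      [\/ I = `[t J, t J.+1]%classic, I = `[t J, t J.+1[%classic | I = `[t J, +oo[%classic] /\
      E = \bigcup_(j < J) (`[t j, t j.+1]%classic `*` [set j]) `|` I `*` [set J]].

Definition time_slice (R : realType) (E : set (R * nat)) (j : nat) : set R :=
  [set t | E (t, j)].

Definition unbounded_domain (R : realType) (E : set (R * nat)) :=
  ~ exists M : R, forall t j, E (t, j) -> t <= M /\ j%:R <= M.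

Definition switching_times (R : realType) (E : set (R * nat)) : set R :=
  [set t | exists j, E (t, j) /\ E (t, j.+1)].

(* The pair (x, q), so z.1 is x and z.2 is q. *)
Definition state (R : realType) (N : nat) : Type := ('cV[R]_N * 'cV[R]_N)%type.

Definition quantizer_levels (R : realType) (Delta : R) : set R :=
  [set y | exists k : int, y = Delta * k%:~R \/ y = Delta * k%:~R + Delta / 2].

Definition state_space (R : realType) (N : nat) (Delta : R) : set (state R N) :=
  [set z : state R N | forall i, quantizer_levels Delta (z.2 i 0)].

Definition flow_set (R : realType) (N : nat) (Delta : R) : set (state R N) :=
  [set z : state R N | state_space Delta z /\
    forall i, z.2 i 0 - Delta / 2 < z.1 i 0 < z.2 i 0 + Delta / 2].

Definition jump_set (R : realType) (N : nat) (Delta : R) : set (state R N) :=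
  state_space Delta `\` flow_set Delta.

Definition initial_set (R : realType) (N : nat) (Delta : R) : set (state R N) :=
  [set z : state R N | state_space Delta z /\
    forall i, z.2 i 0 - Delta / 2 <= z.1 i 0 < z.2 i 0 + Delta / 2].

Definition flow_map (R : realType) (N : nat) (G : wdigraph R N)
    (z : state R N) : state R N :=
  (- (laplacian G *m z.2), 0).

Definition jump_map (R : realType) (N : nat) (Delta : R) (z : state R N) :
    state R N :=
  (z.1, \col_i
    (if z.2 i 0 + Delta / 2 <= z.1 i 0 then z.2 i 0 + Delta / 2
     else if z.1 i 0 <= z.2 i 0 - Delta / 2 then z.2 i 0 - Delta / 2
     else z.2 i 0)).

(* A solution is given by its domain E together with a function z that is
   total, but whose values outside E are irrelevant: they could only influence
   the derivative at the endpoints of a slice, which form a null set. *)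
Record hybrid_solution (R : realType) (N : nat) (G : wdigraph R N) (Delta : R)
    (E : set (R * nat)) (z : R -> nat -> state R N) : Prop := HybridSolution {
  sol_domain : hybrid_time_domain E;
  sol_abs_continuous : forall j,
    locally_abs_continuous (time_slice E j) (fun t => z t j);
  sol_init : E (0, 0%N) /\ (flow_set Delta `|` jump_set Delta) (z 0 0%N);
  sol_flow : forall j, (time_slice E j)° !=set0 ->
    (\forall t \ae (@lebesgue_measure R), time_slice E j t ->
      is_derive (t : R) (1 : R) (fun s : R => z s j) (flow_map G (z t j))) /\
    (* slices are closed on the left, so [min I_j, sup I_j) is the set of
       points of the slice below its (possibly infinite) supremum *)
    (forall t, time_slice E j t ->
      (t%:E < ereal_sup (EFin @` time_slice E j))%E ->
      flow_set Delta (z t j));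
  sol_jump : forall t j, E (t, j) -> E (t, j.+1) ->
    jump_set Delta (z t j) /\ z t j.+1 = jump_map Delta (z t j) }.

Definition complete_solution (R : realType) (N : nat) (G : wdigraph R N)
    (Delta : R) (E : set (R * nat)) (z : R -> nat -> state R N) :=
  hybrid_solution G Delta E z /\ unbounded_domain E.

(* Main.v *)
Require Import Defs.
From mathcomp Require Import all_boot all_order all_algebra.
From mathcomp Require Import all_classical all_reals all_analysis.
From mathcomp Require Import lra.
Import Order.TTheory GRing.Theory Num.Theory.
Import numFieldNormedType.Exports.
Local Open Scope classical_set_scope.
Local Open Scope ring_scope.

(** An absolutely continuous function whose difference quotients are
    bounded by [M] at almost every point is [M]-Lipschitz, so on a slice [q] is
    constant and [x] moves at speed at most [|L q|].  Since [|x_i - q_i|] never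
    exceeds [Delta / 2], the norm of [x] grows at most exponentially in time,
    whence [|L q|] is bounded by some [B] over any bounded time.  A component
    that jumps has [x_i = q_i] right afterwards and must move by [Delta / 2]
    before it jumps again, which takes at least [Delta / (2 B)]; as there are
    only [N] components, bounded time intervals contain finitely many jumps. *)

(** * Increments of absolutely continuous functions *)

(** Real induction: points satisfying [P] approach their supremum [s], and the step at [s] carries
    [P] across it. As [eta] may depend on [s], this plays the role of Cousin's covering lemma. *)
Lemma itv_gauge_ind (R : realType) (a b : R) (P : R -> Prop) :
  a <= b -> P a ->
  (forall s, a <= s <= b -> exists2 eta, 0 < eta &
     forall t u, a <= t -> s - eta < t -> t <= s -> s <= u -> u < s + eta ->
       u <= b -> P t -> P u) ->
  P b.
Proof.
move=> ab Pa step.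
pose S := [set t | a <= t <= b /\ P t].
have Sa : S a by rewrite /S /= lexx ab.
have ubS : ubound S b by move=> t [/andP[_ ->]].
have supS : has_sup S by split; [exists a|exists b].
set s := sup S.
have as_ : a <= s by apply: sup_upper_bound.
have sb : s <= b by apply: sup_le_ub => //; exists a.
have [eta eta0 /(_ _) stp] : exists2 eta, 0 < eta &
     forall t u, a <= t -> s - eta < t -> t <= s -> s <= u -> u < s + eta ->
       u <= b -> P t -> P u by apply: step; rewrite as_ sb.
have [t St st] := sup_adherent eta0 supS.
have ts : t <= s by apply: sup_upper_bound.
case: St => /andP[at_ tb] Pt.
have [bs|sb'] := ltP b (s + eta).
  exact: (stp t b).
have : s + eta / 2 <= s.
  apply: sup_upper_bound => //; split; first by lra.
  by apply: (stp t) => //; lra.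
by lra.
Qed.

(** Lists ordered from right to left suit an induction that prepends intervals; the order makes the
    open intervals disjoint. *)
Lemma abs_continuous_seq (R : realType) (V : normedModType R) (a b : R)
    (f : R -> V) (e : R) : abs_continuous a b f -> 0 < e ->
  exists2 d : R, 0 < d & forall s : seq (R * R),
    all (fun p => [&& a <= p.1, p.1 <= p.2 & p.2 <= b]) s ->
    pairwise (fun p q => q.2 <= p.1) s ->
    \sum_(p <- s) (p.2 - p.1) < d ->
    \sum_(p <- s) `|f p.2 - f p.1| < e.
Proof.
move=> acf e0; have [d d0 H] := acf e e0; exists d => // s sab sp.
rewrite !(big_nth (0, 0)) !big_mkord => sd.
apply: (H _ (fun i => (nth (0, 0) s i).1) (fun i => (nth (0, 0) s i).2)) => //.
  by move=> k; have /and3P[] := all_nthP (0, 0) sab k (ltn_ord k).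
have aux (i j : 'I_(size s)) : (i < j)%N ->
    (nth (0, 0) s j).2 <= (nth (0, 0) s i).1.
  by move=> ij; apply: (pairwiseP (0, 0) sp); rewrite ?inE.
move=> i j _ _ [x []]; rewrite /= !in_itv/= => /andP[i1 i2] /andP[j1 j2].
apply/val_inj; case: (ltngtP i j) => // /aux ij; exfalso; lra.
Qed.

Local Notation mu := lebesgue_measure.

(** Around points of the exceptional null set, intervals of small total length contribute at most
    [e] by absolute continuity; elsewhere the local bound applies. [itv_gauge_ind] glues the
    pieces. *)
Lemma ae_lipschitz_increment (R : realType) (V : normedModType R)
    (a b M : R) (f : R -> V) : a <= b -> 0 <= M -> abs_continuous a b f ->
  (\forall t \ae (@lebesgue_measure R), `[a, b]%classic t ->
     forall e : R, 0 < e ->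
     \forall y \near t, `|f y - f t| <= (M + e) * `|y - t|) ->
  `|f b - f a| <= M * (b - a).
Proof.
move=> ab M0 acf [Z [mZ Z0 subZ]].
suff H (e : R) : 0 < e -> `|f b - f a| <= (M + e) * (b - a) + e.
  apply/ler_addgt0Pr => e e0.
  (* With [e / (b - a + 1)] in place of [e], the two error terms of [H] add up to [e]. *)
  have d0 : 0 < b - a + 1 by lra.
  have /H : 0 < e / (b - a + 1) by rewrite divr_gt0.
  move=> /le_trans; apply.
  rewrite mulrDl -addrA lerD2l -[X in _ + X]mulr1 -mulrDr divfK//; lra.
move=> e0.
have [d d0 Hd] := abs_continuous_seq _ _ _ _ _ e acf e0.
have [U [oU ZU Ud]] : exists U : set R, [/\ open U, Z `<=` U & (mu U < d%:E)%E].
  have [|U [oU ZU Ud]] := @lebesgue_regularity_outer R Z d mZ _ d0.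
    by rewrite [X in (X < _)%E]Z0.
  exists U; split => //.
  have mU : measurable U by apply: measurable_realfun.open_measurable.
  rewrite -(setDKU ZU) measureU//; first by rewrite [X in (_ + X)%E]Z0 adde0.
  - exact: measurableD.
  - by rewrite setIC setDIK.
have mU : measurable U by apply: measurable_realfun.open_measurable.
have le_mu (A B : set R) : measurable A -> measurable B -> A `<=` B ->
    (mu A <= mu B)%E.
  by move=> mA mB AB; apply: le_measure; rewrite ?inE.
(* [s] lists the intervals used around points of [Z]; they lie in [U] and are
   stored from right to left *)
pose P t := exists s : seq (R * R),
  [/\ all (fun p => [&& a <= p.1, p.1 <= p.2 & p.2 <= t]) s,
      pairwise (fun p q => q.2 <= p.1) s,
      ((\sum_(p <- s) (p.2 - p.1))%:E <= mu (U `&` `]-oo, t]))%E &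
      `|f t - f a| <= (M + e) * (t - a) + \sum_(p <- s) `|f p.2 - f p.1|].
have monoP s (t u : R) : t <= u ->
    all (fun p : R * R => [&& a <= p.1, p.1 <= p.2 & p.2 <= t]) s ->
   all (fun p : R * R => [&& a <= p.1, p.1 <= p.2 & p.2 <= u]) s.
  by move=> tu; apply: sub_all => p /and3P[-> ->] /= /le_trans; apply.
have mUt t : measurable (U `&` `]-oo, t]) by apply: measurableI.
have [s [s1 s2 s3 s4]] : P b.
  apply: (@itv_gauge_ind _ a b) => //.
    exists [::]; split => //; first by rewrite big_nil.
    by rewrite subrr normr0 big_nil subrr mulr0 addr0.
  move=> x xab.
  (* If [x] is in [Z], the pair [(t, u)] joins the list, its length paid for by the part of [U]
     between [t] and [u]. Otherwise the list stays and the increment is split at [x]. *)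
  have [Zx|nZx] := pselect (Z x).
    have : nbhs x U by apply: open_nbhs_nbhs; split => //; apply: ZU.
    move=> /nbhs_ballP[eta /= eta0 xU]; exists eta => //.
    move=> t u at_ t1 t2 u1 u2 ub [s [s1 s2 s3 s4]].
    have tuU y : t <= y <= u -> U y.
      by move=> /andP[ty yu]; apply: xU; rewrite /ball/= ltr_distlC; lra.
    exists ((t, u) :: s); split => /=.
    - rewrite at_ lexx (le_trans t2 u1) /=; exact: monoP (le_trans t2 u1) _.
    - by rewrite s2 andbT; apply/allP => p /(allP s1) /and3P[].
    - rewrite big_cons /= EFinD.
      have tu := le_trans t2 u1.
      apply: (@le_trans _ _ (mu (`]t, u] `|` (U `&` `]-oo, t]))%classic)).
        rewrite measureU//.
          apply: leeD => //.
          rewrite [leRHS]lebesgue_measure_itv /= lte_fin.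
          case: ifP => // /negbT; rewrite -leNgt => ut.
          by rewrite lee_fin; lra.
          exact: mUt.
        apply/seteqP; split => y //= [] /=.
        by rewrite !in_itv/= => /andP[ty _] [_]; lra.
      apply: le_mu => //.
        by apply: measurableU.
      move=> y [|[]] /=; rewrite !in_itv/=.
        by move=> /andP[y1 y2]; split => //; apply: tuU; lra.
      by move=> Uy yt; split => //; lra.
    - rewrite big_cons /=.
      have := ler_distD (f t) (f u) (f a).
      have : 0 <= (M + e) * (u - t) by apply: mulr_ge0; lra.
      lra.
  have : `[a, b]%classic x ->
     forall e : R, 0 < e ->
     \forall y \near x, `|f y - f x| <= (M + e) * `|y - x|.
    by apply: contrapT => nx; apply: nZx; apply: subZ.
  rewrite /= in_itv/= => /(_ xab e e0).
  move=> /nbhs_ballP[eta /= eta0 Hx]; exists eta => //.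
  move=> t u at_ t1 t2 u1 u2 ub [s [s1 s2 s3 s4]].
  have tu := le_trans t2 u1.
  exists s; split => //.
  - exact: monoP s1.
  - apply: le_trans s3 _; apply: le_mu => //.
    by move=> y [Uy] /=; rewrite !in_itv/= => yt; split => //; lra.
  - have := ler_distD (f t) (f u) (f a).
    have := ler_distD (f x) (f u) (f t).
    have : `|f t - f x| <= (M + e) * `|t - x|.
      by apply: Hx; rewrite /ball/= ltr_distlC; lra.
    have : `|f u - f x| <= (M + e) * `|u - x|.
      by apply: Hx; rewrite /ball/= ltr_distlC; lra.
    rewrite (distrC (f t) (f x)) (distrC t x) (ger0_norm (_ : 0 <= u - x)).
      by rewrite (ger0_norm (_ : 0 <= x - t)); lra.
    by lra.
apply: (le_trans s4); rewrite lerD2l ltW// Hd//.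
rewrite -lte_fin; apply: (le_lt_trans s3); apply: le_lt_trans Ud.
by apply: le_mu => // y [].
Qed.

Lemma abs_continuous_dominated (R : realType) (V W : normedModType R)
    (a b c d : R) (f : R -> V) (g : R -> W) : a <= c -> d <= b ->
  (forall u v, `|g v - g u| <= `|f v - f u|) ->
  abs_continuous a b f -> abs_continuous c d g.
Proof.
move=> ac db gf acf e e0; have [del del0 H] := acf e e0.
exists del => // n u v uv tr uvd.
apply: le_lt_trans (H n u v _ tr uvd); first exact: ler_sum.
by move=> k; have [cu [uvk vd]] := uv k; split; [|split]; lra.
Qed.

Lemma is_derive_near_increment (R : realType) (V : normedModType R)
    (f : R -> V) (t : R) (df : V) (e : R) : is_derive t 1 f df -> 0 < e ->
  \forall y \near t, `|f y - f t - (y - t) *: df| <= e * `|y - t|.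
Proof.
move=> [dfx dfE] e0.
have : (fun h : R => h^-1 *: ((f \o shift t) (h *: 1) - f t)) @ 0^' --> df.
  by rewrite -dfE; exact: dfx.
move=> /cvgr_dist_le /(_ e e0).
rewrite near_withinE => /nbhs_ballP[eta /= eta0 H].
apply/nbhs_ballP; exists eta => // y /= ty.
have [->|yt] := eqVneq y t.
  by rewrite !subrr scale0r subr0 !normr0 mulr0.
have yt0 : y - t != 0 by rewrite subr_eq0.
have {}H : `|df - (y - t)^-1 *: (f y - f t)| <= e.
  have := H (y - t); rewrite /ball /= sub0r normrN distrC => /(_ ty yt0).
  by rewrite [(y - t) *: 1]mulr1 subrK.
have -> : f y - f t - (y - t) *: df =
    (y - t) *: ((y - t)^-1 *: (f y - f t) - df).
  by rewrite scalerBr scalerA divff// scale1r.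
by rewrite normrZ mulrC; apply: ler_wpM2r => //; rewrite distrC.
Qed.

(** * Norm estimates and the flow on an interval *)

Lemma coord_le_norm (R : realType) (N : nat) (v : 'cV[R]_N) i :
  `|v i 0| <= `|v|.
Proof.
rewrite [leRHS]mx_normrE.
exact: (le_bigmax _ (fun ij : 'I_N * 'I_1 => `|v ij.1 ij.2|) (i, 0)).
Qed.

Lemma norm_le_coord (R : realType) (N : nat) (v : 'cV[R]_N) (m : R) : 0 <= m ->
  (forall i, `|v i 0| <= m) -> `|v| <= m.
Proof.
move=> m0 vm; rewrite [leLHS]mx_normrE; apply/bigmax_leP; split => // -[i j] _.
by rewrite /= (ord1 j).
Qed.

Lemma norm_mulmx_le (R : realType) (N : nat) (L : 'M[R]_N) :
  exists2 c, 0 <= c & forall v : 'cV[R]_N, `|L *m v| <= c * `|v|.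
Proof.
exists (\sum_i \sum_j `|L i j|) => [|v].
  by apply: sumr_ge0 => i _; apply: sumr_ge0.
apply: norm_le_coord => [|i].
  by apply: mulr_ge0 => //; apply: sumr_ge0 => i _; apply: sumr_ge0.
rewrite mxE (le_trans (ler_norm_sum _ _ _))//.
apply: (@le_trans _ _ ((\sum_j `|L i j|) * `|v|)).
  rewrite mulr_suml; apply: ler_sum => j _.
  by rewrite normrM; apply: ler_wpM2l => //; exact: coord_le_norm.
apply: ler_wpM2r => //; rewrite [leRHS](bigD1 i)//= lerDl.
by apply: sumr_ge0 => k _; apply: sumr_ge0.
Qed.

Lemma lebesgue_ae_mono (R : realType) (P Q : R -> Prop) :
  (forall t, P t -> Q t) -> (\forall t \ae (@lebesgue_measure R), P t) ->
  \forall t \ae (@lebesgue_measure R), Q t.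
Proof. by move=> PQ; apply: negligibleS => t nQ /PQ. Qed.

(** First [q] is constant, being Lipschitz with constant 0; then [x] has the same velocity at almost
    every time, and the norm of that vector is its Lipschitz constant. *)
Lemma flow_increment (R : realType) (N : nat) (G : wdigraph R N)
    (w : R -> state R N) (a b : R) : a <= b -> abs_continuous a b w ->
  (\forall t \ae (@lebesgue_measure R), `[a, b]%classic t ->
     is_derive (t : R) (1 : R) w (flow_map G (w t))) ->
  forall t, a <= t <= b -> (w t).2 = (w a).2 /\
    forall s, a <= s <= t ->
      `|(w t).1 - (w s).1| <= `|laplacian G *m (w a).2| * (t - s).
Proof.
move=> ab acw dw.
have incr t : is_derive (t : R) (1 : R) w (flow_map G (w t)) ->
  forall e : R, 0 < e -> \forall y \near t,
   `|(w y).2 - (w t).2| <= (0 + e) * `|y - t| /\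
   `|(w y).1 - (w t).1| <= (`|laplacian G *m (w t).2| + e) * `|y - t|.
  move=> dwt e e0; near=> y.
  have : `|w y - w t - (y - t) *: flow_map G (w t)| <= e * `|y - t|.
    by near: y; exact: is_derive_near_increment.
  rewrite prod_normE ge_max /= => /andP[h1 h2]; split.
    by move: h2; rewrite scaler0 subr0 add0r.
  rewrite -[_ - _](subrK ((y - t) *: - (laplacian G *m (w t).2))).
  rewrite (le_trans (ler_normD _ _))// mulrDl addrC lerD//.
  by rewrite normrZ normrN [leRHS]mulrC.
have q_const t : a <= t <= b -> (w t).2 = (w a).2.
  move=> /andP[at_ tb]; apply/eqP.
  rewrite -subr_eq0 -normr_le0 -(mul0r (t - a)).
  apply: (ae_lipschitz_increment _ _ a t 0 (fun s => (w s).2)) => //.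
    apply: abs_continuous_dominated acw => // u v.
    by rewrite prod_normE le_max lexx orbT.
  apply: lebesgue_ae_mono dw => s ds /=; rewrite in_itv/= => /andP[as_ st] e e0.
  have {}ds := ds _; rewrite /= in_itv/= as_ (le_trans st tb) in ds.
  by apply: filterS (incr _ (ds isT) _ e0) => y [].
move=> t tab; split; first exact: q_const.
move=> s /andP[as_ st]; case/andP: tab => at_ tb.
apply: (ae_lipschitz_increment _ _ s t _ (fun s => (w s).1)) => //.
  apply: abs_continuous_dominated acw => // u v.
  by rewrite prod_normE le_max lexx.
apply: lebesgue_ae_mono dw => r dr /=; rewrite in_itv/= => /andP[sr rt] e e0.
have rab : a <= r <= b by lra.
have {}dr := dr _; rewrite /= in_itv/= rab in dr.
have := incr _ (dr isT) _ e0; rewrite q_const//; apply: filterS => y [].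
Unshelve. all: by end_near.
Qed.

(** * Jump sequences cannot accumulate in time *)

Section discrete.
Variables (R : realType) (N : nat) (L : 'M[R]_N) (Delta : R).
(** [x j] and [q j] are sampled at the start of slice [j]. Jumps preserve [x], so [x j.+1] is also
    the position at the end of slice [j], and [x j.+1 - q j] decides which components jump. *)
Variables (t : nat -> R) (x q : nat -> 'cV[R]_N).
Hypothesis Delta_gt0 : 0 < Delta.
Hypothesis t_nondecreasing : nondecreasing_seq t.
Hypothesis x_increment :
  forall j, `|x j.+1 - x j| <= `|L *m q j| * (t j.+1 - t j).
Hypothesis q_stay : forall j i,
  `|x j.+1 i 0 - q j i 0| < Delta / 2 -> q j.+1 i 0 = q j i 0.
Hypothesis q_jump : forall j i,
  `|x j.+1 i 0 - q j i 0| = Delta / 2 -> q j.+1 i 0 = x j.+1 i 0.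
Hypothesis init_near : forall i, `|x 0%N i 0 - q 0%N i 0| <= Delta / 2.
Hypothesis flow_near : forall j,
  (forall i, `|x j i 0 - q j i 0| <= Delta / 2) ->
  forall i, `|x j.+1 i 0 - q j i 0| <= Delta / 2.
Hypothesis some_jump : forall j, exists i, Delta / 2 <= `|x j.+1 i 0 - q j i 0|.

Lemma state_near j i : `|x j i 0 - q j i 0| <= Delta / 2.
Proof.
elim: j i => // j IH i; have := flow_near j IH i.
rewrite le_eqVlt => /predU1P[/q_jump->|/[dup] h /q_stay->]; last exact: ltW.
by rewrite subrr normr0 divr_ge0// ltW.
Qed.

(** Discrete Gronwall argument: [y] dominates the norm of [q] and grows per step by a factor at most
    [1 + c * (t j.+1 - t j)], hence at most the exponential of [c * (t j.+1 - t j)]. *)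
Lemma quantizer_bounded (T : R) : (forall j, t j <= T) ->
  exists2 B, 0 < B & forall j, `|L *m q j| <= B.
Proof.
move=> tT; have [c c0 Lc] := norm_mulmx_le R N L.
pose y j := `|x j| + Delta / 2.
have y_ge0 j : 0 <= y j by rewrite addr_ge0// divr_ge0// ltW.
have qy j : `|q j| <= y j.
  apply: norm_le_coord => // i.
  have := state_near j i; have := coord_le_norm R N (x j) i.
  have := ler_distD 0 (q j i 0) (x j i 0).
  have := ler_distD (x j i 0) (q j i 0) 0.
  rewrite !subr0 (distrC (q j i 0)) /y; lra.
have yexp j : y j <= expR (c * (t j - t 0%N)) * y 0%N.
  elim: j => [|j IH]; first by rewrite subrr mulr0 expR0 mul1r.
  have tj : 0 <= t j.+1 - t j by rewrite subr_ge0; apply: t_nondecreasing.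
  apply: (@le_trans _ _ ((1 + c * (t j.+1 - t j)) * y j)).
    have : `|x j.+1| <= `|x j| + c * y j * (t j.+1 - t j).
      have := ler_distD (x j) (x j.+1) 0; rewrite !subr0.
      have : `|L *m q j| * (t j.+1 - t j) <= c * y j * (t j.+1 - t j).
        apply: ler_wpM2r => //; apply: le_trans (Lc _) _.
        exact: ler_wpM2l.
      have := x_increment j; lra.
    rewrite /y; lra.
  have -> : c * (t j.+1 - t 0%N) = c * (t j.+1 - t j) + c * (t j - t 0%N).
    by lra.
  rewrite expRD -mulrA; apply: ler_pM => //; last exact: expR_ge1Dx.
  by rewrite addr_ge0// mulr_ge0.
(* The added [1] keeps the bound positive even if [c = 0]. *)
exists (c * (expR (c * (T - t 0%N)) * y 0%N) + 1) => [|j].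
  by rewrite ltr_wpDl// !mulr_ge0// expR_ge0.
apply: le_trans (Lc _) _; apply: ler_wpDr => //; apply: ler_wpM2l => //.
apply: le_trans (qy j) _; apply: le_trans (yexp j) _; apply: ler_wpM2r => //.
by rewrite ler_expR; apply: ler_wpM2l => //; rewrite lerB.
Qed.

Lemma no_zeno (T : R) : ~ (forall j, t j <= T).
Proof.
move=> tT; have [B B0 LB] := quantizer_bounded T tT.
have suptN : has_sup (range t).
  by split; [exists (t 0%N), 0%N | exists T => _ [j _ <-]].
(* After step [J] less time remains than is needed to travel [Delta / 2] at speed [B]. *)
have d0 : 0 < Delta / 2 / B by rewrite !divr_gt0.
have [_ [J _ <-] tJ] := sup_adherent d0 suptN.
have tkJ k : B * (t k - t J) < Delta / 2.
  have : t k <= sup (range t) by apply: sup_upper_bound => //; exists k.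
  by rewrite mulrC -ltr_pdivlMr//; lra.
have x_step k i : `|x k.+1 i 0 - x k i 0| <= B * (t k.+1 - t k).
  have := coord_le_norm R N (x k.+1 - x k) i; rewrite !mxE => /le_trans; apply.
  apply: le_trans (x_increment k) _; apply: ler_wpM2r => //.
  by rewrite subr_ge0; apply: t_nondecreasing.
(* [S k] contains the components that have jumped since step [J]: having moved from the centre
   of their cell for a short time only, they cannot jump again *)
pose S k := [set i | `|x k i 0 - q k i 0| <= B * (t k - t J)]%SET.
have SS k : (J <= k)%N -> (#|S k| < #|S k.+1|)%N.
  move=> Jk; have xq i : i \in S k ->
      `|x k.+1 i 0 - q k i 0| <= B * (t k.+1 - t J).
    rewrite inE => h; have := x_step k i.
    have := ler_distD (x k i 0) (x k.+1 i 0) (q k i 0); lra.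
  apply: proper_card; apply/properP; split.
    apply/fintype.subsetP => i /xq h; rewrite inE q_stay//.
    exact: le_lt_trans h (tkJ _).
  (* The jumping component is recentred, so it enters [S k.+1]; it was not in [S k], whose members
     stay closer than [Delta / 2] to their centres. So the cardinal grows at every step and would
     exceed [N]. *)
  have [i hi] := some_jump k; exists i.
    rewrite inE q_jump; last first.
      by apply/eqP; rewrite eq_le hi andbT; apply: flow_near; apply: state_near.
    rewrite subrr normr0 mulr_ge0 ?(ltW B0)// subr_ge0.
    exact/t_nondecreasing/leqW.
  by apply/negP => /xq /le_lt_trans /(_ (tkJ _)); rewrite ltNge hi.
have cardS n : (n <= #|S (J + n)|)%N.
  elim: n => // n IH; rewrite addnS; apply: leq_ltn_trans IH _.
  exact/SS/leq_addr.
have := cardS N.+1; rewrite leqNgt ltnS => /negP; apply.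
by rewrite -[X in (_ <= X)%N]card_ord max_card.
Qed.

End discrete.

(** * One slice of a solution and the jump map *)

(** The flow condition excludes the right end [b], so the last bound is obtained there as a limit
    from the left; on a degenerate slice [a = b] it is its own premise. *)
Lemma slice_flow (R : realType) (N : nat) (G : wdigraph R N) (Delta : R)
    (E : set (R * nat)) (z : R -> nat -> state R N) (j : nat) (a b : R) :
  hybrid_solution G Delta E z -> a <= b -> time_slice E j = `[a, b]%classic ->
  [/\ (z b j).2 = (z a j).2,
      `|(z b j).1 - (z a j).1| <= `|laplacian G *m (z a j).2| * (b - a) &
      (forall i, `|(z a j).1 i 0 - (z a j).2 i 0| <= Delta / 2) ->
      forall i, `|(z b j).1 i 0 - (z a j).2 i 0| <= Delta / 2].
Proof.
move=> [_ acz _ flowz _] + Ej.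
rewrite le_eqVlt => /predU1P[<-|ab]; first by rewrite !subrr normr0 mulr0.
have [] := flowz j.
  exists ((a + b) / 2); rewrite Ej; apply/nbhs_ballP.
  exists ((b - a) / 2) => /=.
    by rewrite divr_gt0// subr_gt0.
  by move=> y; rewrite /ball/= ltr_distlC in_itv/=; lra.
rewrite Ej => dz zC; have leab := ltW ab.
have acj : abs_continuous a b (fun t => z t j) by apply: (acz j); rewrite ?Ej.
have flow := flow_increment _ _ _ _ _ _ leab acj dz.
have bab : a <= b <= b by rewrite lexx leab.
have aab : a <= a <= b by rewrite lexx leab.
have [qb xb] := flow b bab; split => //; first exact: xb.
move=> _ i; apply/ler_addgt0Pr => e e0.
set v := `|laplacian G *m _| in xb.
have v0 : 0 <= v by exact: normr_ge0.
have ev : 0 < e / (v + 1) by rewrite divr_gt0// ltr_wpDl.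
(* Between [s] and [b] the position moves by at most [e]; [v + 1] avoids dividing by zero. *)
pose s := Num.max a (b - e / (v + 1)).
have sa : a <= s by rewrite le_max lexx.
have sb : s < b by rewrite gt_max ab/=; lra.
have sab : a <= s <= b by rewrite sa ltW.
have [_ /(_ i)] : flow_set Delta (z s j).
  apply: zC; first by rewrite /= in_itv.
  apply: (@lt_le_trans _ _ b%:E); first by rewrite lte_fin.
  by apply: ereal_sup_ubound; exists b => //=; rewrite in_itv.
have [-> _] := flow s sab.
have : `|(z b j).1 i 0 - (z s j).1 i 0| <= e.
  have := coord_le_norm R N ((z b j).1 - (z s j).1) i; rewrite !mxE.
  move=> /le_trans; apply; apply: (le_trans (xb s _)); first by rewrite sa ltW.
  apply: (@le_trans _ _ ((v + 1) * (e / (v + 1)))).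
    apply: ler_pM => //; [by rewrite subr_ge0 ltW|by rewrite lerDl|].
    have : b - e / (v + 1) <= s by rewrite le_max lexx orbT.
    lra.
  by rewrite mulrC divfK// gt_eqF// ltr_wpDl.
rewrite !ler_distl; lra.
Qed.

Lemma jump_map_stay (R : realType) (N : nat) (Delta : R) (z : state R N) i :
  `|z.1 i 0 - z.2 i 0| < Delta / 2 -> (jump_map Delta z).2 i 0 = z.2 i 0.
Proof.
by rewrite mxE ltr_distl => ?; case: leP => ?; [|case: leP => ?]; lra.
Qed.

Lemma jump_map_center (R : realType) (N : nat) (Delta : R) (z : state R N) i :
  `|z.1 i 0 - z.2 i 0| = Delta / 2 -> (jump_map Delta z).2 i 0 = z.1 i 0.
Proof.
rewrite mxE => far; case: leP => ?; [|case: leP => ?];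
  by move: far; case: ger0P; lra.
Qed.

Lemma jump_set_far (R : realType) (N : nat) (Delta : R) (z : state R N) :
  jump_set Delta z -> exists i, Delta / 2 <= `|z.1 i 0 - z.2 i 0|.
Proof.
move=> [Xz nCz]; apply: contrapT => nfar; apply: nCz; split => // i.
rewrite -ltr_distl ltNge; apply/negP => far.
by apply: nfar; exists i.
Qed.

(** * From hybrid time domains to switching times *)

(** Slices [j] and [j.+1] meet only at [t j.+1], and a switch requires [j < J]. *)
Lemma switching_times_finite_jumps (R : realType) (t : nat -> R) (J : nat)
    (I : set R) (E : set (R * nat)) : I `<=` [set s | t J <= s] ->
  E = \bigcup_(j < J) (`[t j, t j.+1]%classic `*` [set j]) `|` I `*` [set J] ->
  finite_set (switching_times E).
Proof.
move=> IJ ->; apply: (@sub_finite_set _ _ (t @` `I_J.+1)).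
  move=> s [j [Ej Ej1]].
  have jJ : (j < J)%N.
    by case: Ej1 => [[k /= kJ [_ ->]]|[_ /= <-]] //; exact: ltnW.
  exists j.+1 => //=.
  have sj : s <= t j.+1.
    case: Ej => [[k _ [/= + jk]]|[_ /= jk]]; last by rewrite jk ltnn in jJ.
    by rewrite -jk in_itv/= => /andP[].
  have js : t j.+1 <= s.
    case: Ej1 => [[k _ [/= + jk]]|[/= Is jk]]; last by rewrite jk; apply: IJ.
    by rewrite -jk in_itv/= => /andP[].
  by apply/le_anti; rewrite sj js.
by apply: finite_image; exact: finite_II.
Qed.

(** Sampling the solution at the start of each slice yields sequences to which [no_zeno] applies. *)
Lemma infinite_jumps_unbounded (R : realType) (N : nat) (G : wdigraph R N)
    (Delta : R) (t : nat -> R) (E : set (R * nat)) (z : R -> nat -> state R N) :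
  0 < Delta -> hybrid_solution G Delta E z ->
  initial_set Delta (z (t 0%N) 0%N) -> nondecreasing_seq t ->
  E = \bigcup_j (`[t j, t j.+1]%classic `*` [set j]) ->
  forall T, exists j, T < t j.
Proof.
move=> D0 zsol zinit t_nd EE T; apply: contrapT => nT.
have t_succ j : t j <= t j.+1 by apply: t_nd.
have Ej j : time_slice E j = `[t j, t j.+1]%classic.
  rewrite EE; apply/seteqP; split => s; first by move=> [k _ [/= + ->]].
  by move=> sj; exists j.
have flow j := slice_flow _ _ _ _ _ _ _ _ _ zsol (t_succ j) (Ej j).
have jump j : jump_set Delta (z (t j.+1) j) /\
    z (t j.+1) j.+1 = jump_map Delta (z (t j.+1) j).
  apply: (sol_jump zsol).
    by have : time_slice E j (t j.+1) by rewrite Ej /= in_itv/= lexx t_succ.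
  by have : time_slice E j.+1 (t j.+1) by rewrite Ej /= in_itv/= lexx t_succ.
have xjump j : (z (t j.+1) j.+1).1 = (z (t j.+1) j).1 by rewrite (jump j).2.
have qflow j : (z (t j.+1) j).2 = (z (t j) j).2 by have [] := flow j.
apply: (no_zeno R N (laplacian G) Delta t (fun j => (z (t j) j).1)
  (fun j => (z (t j) j).2) D0 t_nd _ _ _ _ _ _ T).
- by move=> j; rewrite xjump; have [] := flow j.
- move=> j i; rewrite xjump -qflow => /jump_map_stay <-.
  by rewrite (jump j).2.
- move=> j i; rewrite xjump -qflow => /jump_map_center <-.
  by rewrite (jump j).2.
- by move=> i; have [_ /(_ i)] := zinit; rewrite ler_distl; lra.
- by move=> j; rewrite xjump; have [] := flow j.
- by move=> j; rewrite xjump -qflow; apply: jump_set_far; have [] := jump j.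
by move=> j; rewrite leNgt; apply/negP => Tj; apply: nT; exists j.
Qed.

Theorem proposition5 (R : realType) (N : nat) (G : wdigraph R N)
    (G_connected : weakly_connected G) (G_balanced : weight_balanced G)
    (Delta : R) (Delta_gt0 : 0 < Delta)
    (E : set (R * nat)) (z : R -> nat -> state R N)
    (z_complete : complete_solution G Delta E z)
    (z_init : initial_set Delta (z 0 0%N)) :
  forall K : set R, compact K -> K `<=` [set t | 0 <= t] ->
    finite_set (switching_times E `&` K).
Proof.
move=> K Kcompact _.
have [zsol _] := z_complete.
have [t [t0 t_nd [EE|[J [I [II EE]]]]]] := sol_domain zsol; last first.
  apply: finite_setIl; apply: switching_times_finite_jumps EE.
  case: II => -> s /=; rewrite in_itv/=;
    by [move=> /andP[]|move=> /andP[]|rewrite andbT].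
have [T KT] : exists T, forall s, K s -> s <= T.
  have [M [_ KM]] := compact_bounded Kcompact.
  exists (M + 1) => s Ks; have := KM (M + 1) _ _ Ks.
  by move=> h; apply: le_trans (ler_norm _) _; apply: h; rewrite ltrDl.
have [n Tn] : exists n, T < t n.
  by apply: (infinite_jumps_unbounded _ _ G Delta t E z); rewrite ?t0.
(* From index [n] on, the times exceed the bound [T] of [K], so only earlier ones can lie in [K]. *)
apply: (@sub_finite_set _ _ (t @` `I_n)); last first.
  by apply: finite_image; exact: finite_II.
move=> s [[j [Ej Ej1]] Ks].
have sj : s = t j.+1.
  move: Ej Ej1; rewrite EE => -[k _ [/= + jk]] [l _ [/= + jl]].
  by rewrite -jk -jl !in_itv/= => /andP[_ ?] /andP[? _]; apply/le_anti/andP.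
exists j.+1 => //=; rewrite ltnNge; apply/negP => /t_nd.
by rewrite -sj => /(lt_le_trans Tn); rewrite ltNge KT.
Qed.
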